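(* Consider a single advertising slot sold by the following hybrid auction. Each advertiser $j$ submits a bid pair $(m_j,c_j)$ (per-impression bid and per-click bid). The auctioneer computes for each advertiser an index $q_j>0$ independent of the bids; the effective bid is $R_j=\max(m_j,c_jq_j)$. The advertiser with the highest effective bid wins; letting $R_{-j^*}$ be the highest competing effective bid, the winner $j^*$ pays $R_{-j^*}$ per impression if $m_{j^*}>c_{j^*}q_{j^*}$, and otherwise pays $R_{-j^*}/q_{j^*}$ per click. The corresponding auction that ignores per-impression bids uses effective bids $c_jq_j$, awards the slot to the highest one, and charges the winner the second highest value of $c_jq_j$ divided by its own $q$ per click. Suppose each advertiser $j$ has per-click value $v_j$ and knows its click-through probability $p_j$ exactly, and bids truthfully $(m_j,c_j)=(v_jp_j,v_j)$. The auctioneer has a prior $\mathcal{Q}_j=\mathrm{Beta}(\alpha_j,\beta_j)$ with $\alpha_j,\beta_j\ge 1$ on the click-through probability of advertiser $j$, each $p_j$ is drawn from $\mathcal{Q}_j$, and $q_j$ is the Gittins index of $\mathcal{Q}_j$ for an arbitrary discount factor $\gamma_a\in[0,1)$. Then the expected revenue of the auctioneer at the current step under the hybrid auction is at least $1-1/e$ times the expected revenue of the corresponding auction that ignores the per-impression bids.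
   Context: $\mathrm{Beta}(\alpha,\beta)$ denotes the distribution on $[0,1]$ with density proportional to $x^{\alpha-1}(1-x)^{\beta-1}$. Gittins index: for a coin whose probability of heads has prior distribution $\mathcal{Q}$ (updated by Bayes' rule after each toss), which yields reward $1$ on heads and is charged an amount $G$ for every toss, and which may be retired at any time, the Gittins index of $\mathcal{Q}$ with discount factor $\gamma_a$ is the largest $G$ for which the optimal expected discounted (rewards at step $t$ multiplied by $\gamma_a^t$) difference between rewards and charges is non-negative. It is at least the mean of $\mathcal{Q}$ and equals the mean when $\gamma_a=0$. *)

(* Defs.v *)
From HB Require Import structures.
From mathcomp Require Import all_boot all_order all_algebra.
From mathcomp Require Import all_classical all_reals.
From mathcomp Require Import topology normedtype sequences exp measure
  lebesgue_measure lebesgue_integral.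

Set Implicit Arguments.
Unset Strict Implicit.
Unset Printing Implicit Defensive.

Import Order.TTheory GRing.Theory Num.Theory.
Local Open Scope classical_set_scope.
Local Open Scope ring_scope.

Section Defs.
Variable R : realType.

Definition beta_kernel (a b x : R) : R :=
  (x `^ (a - 1) * (1 - x) `^ (b - 1)).

Definition beta_norm (a b : R) : R :=
  fine (\int[lebesgue_measure]_(x in `[0%R, 1%R]) (beta_kernel a b x)%:E)%E.

Definition beta_density (a b x : R) : R := beta_kernel a b x / beta_norm a b.

Definition beta_expect (a b : R) (f : R -> \bar R) : \bar R :=
  (\int[lebesgue_measure]_(x in `[0%R, 1%R]) ((beta_density a b x)%:E * f x))%E.

(* Expectation over independent p_j ~ Beta(al j, be j), j : 'I_N, computed as
   an iterated integral (coordinates k-1, ..., 0); for nonnegative measurable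
   integrands this is the integral w.r.t. the product measure (Tonelli). *)
Fixpoint iter_beta_expect (N : nat) (al be : 'I_N -> R) (k : nat)
    (F : ('I_N -> R) -> \bar R) (p : 'I_N -> R) : \bar R :=
  match k with
  | 0 => F p
  | k'.+1 =>
      match insub k' : option 'I_N with
      | Some i => beta_expect (al i) (be i)
          (fun x => iter_beta_expect al be k' F
                      (fun j => if j == i then x else p j))
      | None => iter_beta_expect al be k' F p
      end
  end.

Definition prod_beta_expect (N : nat) (al be : 'I_N -> R)
    (F : ('I_N -> R) -> \bar R) : \bar R :=
  iter_beta_expect al be N F (fun _ => 0).

(* Posterior after heads: Beta(a+1,b); after tails: Beta(a,b+1);
   the predictive probability of heads is the mean a/(a+b).
   gitt_V g G N a b = optimal expected discounted (reward - charge) with at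
   most N further tosses, retirement allowed at any time (so >= 0). *)
Fixpoint gitt_V (g G : R) (N : nat) (a b : R) : R :=
  match N with
  | 0 => 0
  | N'.+1 => Num.max 0
      (a / (a + b) - G
        + g * (a / (a + b) * gitt_V g G N' (a + 1) b
               + b / (a + b) * gitt_V g G N' a (b + 1)))
  end.

(* value when the coin is tossed now (at least once), then played optimally
   with at most N further tosses *)
Definition gitt_W (g G : R) (N : nat) (a b : R) : R :=
  a / (a + b) - G
    + g * (a / (a + b) * gitt_V g G N (a + 1) b
           + b / (a + b) * gitt_V g G N a (b + 1)).

Definition gitt_value (g G a b : R) : R := sup (range (fun N => gitt_W g G N a b)).

Definition gittins (g a b : R) : R := sup [set G : R | 0 <= gitt_value g G a b].

Definition max_others (N : nat) (r : 'I_N -> R) (j : 'I_N) : R :=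
  \big[Num.max/0]_(i | i != j) r i.

Definition winner (n : nat) (r : 'I_n.+1 -> R) : 'I_n.+1 :=
  [arg max_(i > ord0) r i]%O.

(* Hybrid auction, bids (m j, c j), index q; expected revenue at the current
   step given the true click probabilities p (a per-click payment is collected
   with probability p of the winner). *)
Definition hybrid_revenue (n : nat) (m c q p : 'I_n.+1 -> R) : R :=
  let r := fun j => Num.max (m j) (c j * q j) in
  let w := winner r in
  let price := max_others r w in
  if c w * q w < m w then price else price / q w * p w.

Definition click_revenue (n : nat) (c q p : 'I_n.+1 -> R) : R :=
  let r := fun j => c j * q j in
  let w := winner r in
  max_others r w / q w * p w.

End Defs.

(* Main.v *)
(**
Whoever wins the click-only auction, [w], and its price [S] do not depend on
the click-through probabilities.  In the hybrid auction the price is at least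
[S], and a winner charged per click can only be [w] itself, so the hybrid
revenue is at least [S * min (p_w / q_w) 1] pointwise.  It thus suffices that
[(1 - 1/e) E p <= E (min p q)] for [p ~ Beta(a, b)]; since a Gittins index is at
least the mean [m = a / (a + b)], one may take [q = m].

For [q = m] a primitive is compared with the integrand.  With [k] the Beta
kernel, [c x = (a + b) (e min(x, m) - (e - 1) x)] and
[P x = x^(a-1) (1-x)^b u(x)], where [u x = m (e^(x/m) - 1 - x/m)] on [[0, m]]
and [u x = (e - 1) x - m] on [[m, 1]], one has [P' <= k c] on each piece and [P]
is continuous and vanishes at both ends, so [0 <= \int k c].  The choice of [u]
on [[0, m]] is the one that is sharp in the limit [a = 1], [b -> oo], where the
rescaled Beta distribution becomes exponential.
*)
Require Import Defs.
From HB Require Import structures.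
From mathcomp Require Import all_boot all_order all_algebra.
From mathcomp Require Import all_classical all_reals.
From mathcomp Require Import topology normedtype sequences exp measure
  lebesgue_measure lebesgue_integral.
From mathcomp Require Import derive numfun realfun ftc measurable_realfun.
From mathcomp Require Import ring lra.

Set Implicit Arguments.
Unset Strict Implicit.

Import Order.TTheory GRing.Theory Num.Theory.
Import numFieldNormedType.Exports.
Local Open Scope classical_set_scope.
Local Open Scope ring_scope.

(** * Beta integrals *)

Section BetaInequality.
Variable R : realType.
Implicit Types (a b x : R).
Notation mu := (@lebesgue_measure R).

(** Lower bounds on integrals come from here: it suffices to find [F] whose derivative stays below
    [h], and [h] itself is never integrated explicitly. *)
Lemma increment_le_Rintegral (F f h : R -> R) a b : a < b ->
    (forall x, x \in `[a, b] -> is_derive x 1 F (f x)) ->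
    {within `[a, b], continuous f} ->
    mu.-integrable `[a, b] (EFin \o h) ->
    (forall x, x \in `[a, b] -> f x <= h x) ->
  F b - F a <= \int[mu]_(x in `[a, b]) h x.
Proof.
move=> ab dF cf ih fh.
have cF x : x \in `[a, b] -> F @ x --> F x.
  move=> /dF dFx; apply: differentiable_continuous.
  by apply/derivable1_diffP; exact: ex_derive.
have -> : F b - F a = \int[mu]_(x in `[a, b]) f x.
  rewrite /Rintegral (@continuous_FTC2 _ _ F)//.
    split.
    - by move=> x xab; apply: ex_derive; apply: dF; exact: subset_itv_oo_cc.
    - by apply: cvg_at_right_filter; apply: cF; rewrite in_itv/= lexx ltW.
    - by apply: cvg_at_left_filter; apply: cF; rewrite in_itv/= lexx ltW.
  move=> x xab; rewrite derive1E; apply: derive_val; apply: dF.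
  exact: subset_itv_oo_cc.
apply: le_Rintegral => //.
by apply: continuous_compact_integrable => //; exact: segment_compact.
Qed.

Lemma Rintegral_itv_split (f : R -> R) a b x : a <= x -> x <= b ->
    mu.-integrable `[a, b] (EFin \o f) ->
  \int[mu]_(t in `[a, b]) f t =
  \int[mu]_(t in `[a, x]) f t + \int[mu]_(t in `[x, b]) f t.
Proof.
move=> ax xb itf; apply/eqP; rewrite addrC -subr_eq; apply/eqP.
rewrite Rintegral_itvB ?bnd_simp// Rintegral_itv_obnd_cbnd//.
apply: (integrableS _ _ _ itf) => //=.
by apply: subset_itvr; rewrite bnd_simp.
Qed.

Lemma beta_kernel_ge0 a b x : 0 <= beta_kernel a b x.
Proof. by rewrite mulr_ge0 ?powR_ge0. Qed.

Lemma powR_ile1 x y : 0 <= x <= 1 -> 0 <= y -> x `^ y <= 1.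
Proof.
move=> /andP[x0 x1] y0; have := ge0_ler_powR y0 _ _ x1; rewrite powR1.
by apply; rewrite nnegrE.
Qed.

Lemma beta_kernel_le1 a b x : 1 <= a -> 1 <= b -> 0 <= x <= 1 ->
  beta_kernel a b x <= 1.
Proof.
move=> a1 b1 x01; rewrite mulr_ile1 ?powR_ge0 ?powR_ile1 ?subr_ge0//.
by lra.
Qed.

Lemma measurable_beta_kernel a b : measurable_fun [set: R] (beta_kernel a b).
Proof.
apply: measurable_funM; first exact: measurable_powR.
apply: (@measurableT_comp _ _ _ _ _ _ (@powR R ^~ (b - 1))).
  exact: measurable_powR.
exact: measurable_funB.
Qed.

(** With both exponents nonnegative the kernel is at most [1], so the product is bounded and
    measurable on a set of finite measure. *)
Lemma integrable_beta_kernelM a b (c : R -> R) : 1 <= a -> 1 <= b ->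
  {within `[0, 1], continuous c} ->
  mu.-integrable `[0, 1] (EFin \o (fun x => beta_kernel a b x * c x)).
Proof.
move=> a1 b1 cc; apply: measurable_bounded_integrable => //=.
- by rewrite lebesgue_measure_itv/= lte_fin ltr01 -EFinB ltry.
- apply: measurable_funM.
    by apply: measurable_funTS; exact: measurable_beta_kernel.
  exact: subspace_continuous_measurable_fun.
- have [M [Mr cM]] := compact_bounded
    (continuous_compact cc (segment_compact (a:=0) (b:=1))).
  exists M; split=> // y My z /= z01.
  rewrite normrM (ger0_norm (beta_kernel_ge0 _ _ _)) -[leRHS]mul1r ler_pM//.
  - exact: beta_kernel_ge0.
  - by apply: beta_kernel_le1 => //; rewrite in_itv/= in z01.
  - by apply: cM => //; exists z.
Qed.

(* [x `^ (a - 1) * (1 - x) `^ b] is the kernel with [b + 1] for [b] *)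
Lemma is_derive_beta_kernelM a b (u du : R -> R) x : 0 < x < 1 ->
  is_derive x 1 u (du x) ->
  is_derive x 1 (fun y => beta_kernel a (b + 1) y * u y)
    (beta_kernel a b x *
       ((a - 1) * ((1 - x) / x) * u x - b * u x + (1 - x) * du x)).
Proof.
move=> /andP[x0 x1] du_x.
have x10 : 0 < 1 - x by rewrite subr_gt0.
have d1 := is_derive1_powR (a - 1) x0.
have d2 : is_derive x 1 (fun y => (1 - y) `^ (b + 1 - 1))
    ((b + 1 - 1) * (1 - x) `^ (b + 1 - 1 - 1) * -1).
  have dd := is_derive1_powR (b + 1 - 1) x10.
  apply: (@is_derive1_comp _ (@powR R ^~ (b + 1 - 1)) (fun y => 1 - y)).
  by apply: is_derive_eq; rewrite add0r mul1r.
have d3 := is_deriveM (is_deriveM d1 d2) du_x.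
apply: (is_derive_eq d3).
(* Splitting off one factor brings all powers down to exponents [a - 2] and [b - 1], after which the
   two sides agree as rational expressions. *)
have powRS (t r : R) : 0 < t -> t `^ r = t `^ (r - 1) * t.
  move=> t0; have := @powRD R t (r - 1) 1; rewrite subrK powRr1 ?ltW//.
  by apply; rewrite (gt_eqF t0) implybT.
rewrite fctE /beta_kernel /GRing.scale/= addrK.
rewrite (powRS x (a - 1))// (powRS (1 - x) b)//.
by field; rewrite gt_eqF.
Qed.

(** The last hypothesis bounds the derivative of the product divided by [beta_kernel a b x]. The
    endpoints [0] and [1] stay excluded because real powers are differentiated only at a positive
    base. *)
Lemma beta_kernel_increment_le a b (u du c : R -> R) y z : 1 <= a -> 1 <= b ->
    0 < y -> y < z -> z < 1 ->
    (forall x, is_derive x 1 u (du x)) -> continuous du ->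
    {within `[0, 1], continuous c} ->
    (forall x, y <= x <= z ->
      (a - 1) * ((1 - x) / x) * u x - b * u x + (1 - x) * du x <= c x) ->
  beta_kernel a (b + 1) z * u z - beta_kernel a (b + 1) y * u y <=
  \int[mu]_(x in `[y, z]) (beta_kernel a b x * c x).
Proof.
move=> a1 b1 y0 yz z1 du_u cdu cc ule.
have yz01 x : x \in `[y, z] -> 0 < x < 1.
  by rewrite in_itv/=; lra.
pose f x := beta_kernel a b x *
  ((a - 1) * ((1 - x) / x) * u x - b * u x + (1 - x) * du x).
apply: (@increment_le_Rintegral (fun x => beta_kernel a (b + 1) x * u x) f) => //.
- by move=> x /yz01 x01; exact: is_derive_beta_kernelM.
- apply: continuous_in_subspaceT => x /set_mem /= /yz01 /andP[x0 x1].
  have cu : {for x, continuous u}.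
    apply: differentiable_continuous; apply/derivable1_diffP.
    exact: (@ex_derive _ _ _ _ _ _ _ (du_u x)).
  have cpow (r t : R) : 0 < t -> {for t, continuous (@powR R ^~ r)}.
    move=> t0; apply: differentiable_continuous; apply/derivable1_diffP.
    exact: (@ex_derive _ _ _ _ _ _ _ (is_derive1_powR r t0)).
  have conem : {for x, continuous (fun t : R => 1 - t)}.
    by apply: cvgB; [exact: cvg_cst|exact: cvg_id].
  apply: cvgM.
    apply: cvgM; first exact: cpow.
    apply: (@continuous_comp _ _ _ (fun t : R => 1 - t) (@powR R ^~ (b - 1))) => //.
    by apply: cpow; rewrite subr_gt0.
  apply: cvgD; last by apply: cvgM => //; exact: cdu.
  apply: cvgB; last by apply: cvgM => //; exact: cvg_cst.
  apply: cvgM => //; apply: cvgM; first exact: cvg_cst.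
  by apply: cvgM => //; apply: cvgV; [rewrite gt_eqF|exact: cvg_id].
- apply: (integrableS _ _ _ (integrable_beta_kernelM a1 b1 cc)) => //=.
  by apply: subset_itvScc; rewrite bnd_simp ltW.
- move=> x xyz; rewrite ler_wpM2l ?beta_kernel_ge0//; apply: ule.
  by rewrite in_itv/= in xyz.
Qed.

Lemma expR_1Bx_le1 x : expR x * (1 - x) <= 1.
Proof.
rewrite -(ler_pM2l (expR_gt0 (- x))) mulrA -expRD addNr expR0 mul1r mulr1.
by rewrite addrC; apply: le_trans (expR_ge1Dx _); rewrite addrC.
Qed.

Lemma expR1_ge2 : 2 <= expR 1 :> R.
Proof. by apply: le_trans (expR_ge1Dx _); lra. Qed.

Lemma continuous_min_cst (q : R) : continuous (fun x : R => Num.min x q).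
Proof.
move=> x; apply: (@continuous_min R R (fun y => y) (fun=> q) x).
  exact: cvg_id.
exact: cvg_cst.
Qed.

(** * Nonnegativity of the comparison integral, with the mean as threshold *)

Section MinIntegral.
Variables a b : R.
Hypotheses (a1 : 1 <= a) (b1 : 1 <= b).
Let m := a / (a + b).
Let e : R := expR 1.

Let s0 : 0 < a + b. Proof. by move: a1 b1; lra. Qed.
Let a0 : 0 <= a. Proof. by move: a1; lra. Qed.
Let a10 : 0 <= a - 1. Proof. by rewrite subr_ge0. Qed.
Let m0 : 0 < m. Proof. by rewrite divr_gt0//; move: a1 b1; lra. Qed.
Let m1 : m < 1. Proof. by rewrite ltr_pdivrMr// mul1r; move: a1 b1; lra. Qed.
Let e2 : 2 <= e. Proof. exact: expR1_ge2. Qed.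

(** For [x <= m] the right side is [c x]. Since [(a + b) * m = a], the difference of the two sides
    has the factor [E * (1 - x / m) - 1], nonpositive because [1 - t <= expR (- t)]. *)
Let beta_primitive_le_left x : 0 < x ->
  let u := m * (expR (x / m) - 1 - x / m) in
  (a - 1) * ((1 - x) / x) * u - b * u + (1 - x) * (expR (x / m) - 1)
  <= (a + b) * x.
Proof.
move=> x0 /=; set E := expR _.
have := expR_1Bx_le1 (x / m); rewrite -/E => Ey.
rewrite -subr_le0.
have -> : (a - 1) * ((1 - x) / x) * (m * (E - 1 - x / m)) -
   b * (m * (E - 1 - x / m)) + (1 - x) * (E - 1) - (a + b) * x =
   ((a - 1) * m / x + m) * (E * (1 - x / m) - 1).
  by rewrite /m; field; rewrite !gt_eqF// ?(lt_le_trans ltr01).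
rewrite mulr_ge0_le0 ?subr_le0// addr_ge0 ?divr_ge0 ?mulr_ge0 ?invr_ge0//.
all: by rewrite ltW.
Qed.

(** For [x >= m] the right side is [c x]; by [(a + b) * m = a] the difference collapses to minus a
    sum of nonnegative terms. *)
Let beta_primitive_le_right x : 0 < x < 1 ->
  let u := (e - 1) * x - m in
  (a - 1) * ((1 - x) / x) * u - b * u + (1 - x) * (e - 1)
  <= (a + b) * (e * m - (e - 1) * x).
Proof.
move=> /andP[x0 x1] /=; rewrite -subr_le0.
have -> : (a - 1) * ((1 - x) / x) * ((e - 1) * x - m) - b * ((e - 1) * x - m) +
   (1 - x) * (e - 1) - (a + b) * (e * m - (e - 1) * x) =
   - ((a - 1) * ((1 - x) / x) * m + a * m).
  by rewrite /m; field; rewrite !gt_eqF// ?(lt_le_trans ltr01).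
rewrite oppr_le0 addr_ge0 ?mulr_ge0 ?divr_ge0 ?invr_ge0 ?subr_ge0//.
all: by rewrite ltW.
Qed.

Let c x := (a + b) * (e * Num.min x m - (e - 1) * x).

Let cont_c : {within `[0, 1], continuous c}.
Proof.
apply: continuous_subspaceT => x; apply: cvgM; first exact: cvg_cst.
apply: cvgB; apply: cvgM; [exact: cvg_cst| |exact: cvg_cst|exact: cvg_id].
exact: continuous_min_cst.
Qed.

Let f x := beta_kernel a b x * c x.

Let itg y z : 0 <= y -> z <= 1 -> mu.-integrable `[y, z] (EFin \o f).
Proof.
move=> y0 z1.
apply: (integrableS _ _ _ (integrable_beta_kernelM a1 b1 cont_c)) => //=.
by apply: subset_itvScc; rewrite bnd_simp.
Qed.

Let integral_ge_left eps : 0 < eps < m ->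
  beta_kernel a (b + 1) m * (m * (e - 2)) - e * eps
  <= \int[mu]_(x in `[eps, m]) f x.
Proof.
move=> /andP[eps0 epsm].
pose u x := m * (expR (x / m) - 1 - x / m).
have dE x : is_derive x 1 (fun x => expR (x / m)) (expR (x / m) / m).
  apply: (@is_derive1_comp _ (@expR R) (fun x => x / m)).
  by apply: is_derive_eq; rewrite /GRing.scale/= mulr0 add0r mulr1.
have du x : is_derive x 1 u (expR (x / m) - 1).
  apply: is_derive_eq; rewrite /GRing.scale/=.
  by field; rewrite gt_eqF.
have cu : continuous (fun x => expR (x / m) - 1).
  move=> x; apply: cvgB; last exact: cvg_cst.
  apply: (@continuous_comp _ _ _ (fun x => x / m) expR); last exact: continuous_expR.
  by apply: cvgM; [exact: cvg_id|exact: cvg_cst].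
apply: le_trans (beta_kernel_increment_le a1 b1 eps0 epsm m1 du cu cont_c _).
  rewrite /u divff ?gt_eqF// -/e lerB//.
    by rewrite -addrA -opprD.
  rewrite -[leRHS]mul1r ler_pM ?beta_kernel_ge0//.
  - rewrite mulr_ge0 ?(ltW m0)// -addrA -opprD subr_ge0; exact: expR_ge1Dx.
  - apply: beta_kernel_le1; move: a1 b1 epsm m1 eps0; lra.
  (* From [expR y * (1 - y) <= 1] and [y <= 1] follows [expR y - 1 <= y * expR y <= e * y], so the
     boundary term at [eps] is at most [e * m * y = e * eps]. *)
  - set y := eps / m; have y01 : 0 <= y <= 1.
      by rewrite /y divr_ge0 ?(ltW eps0) ?(ltW m0)//= ler_pdivrMr// mul1r ltW.
    have Ey := expR_1Bx_le1 y.
    have Ele : expR y <= e by rewrite ler_expR; case/andP: y01.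
    have -> : eps = m * y by rewrite /y mulrC divfK// gt_eqF.
    rewrite mulrCA ler_pM2l//; nra.
move=> x /andP[epsx xm]; apply: le_trans (beta_primitive_le_left _) _.
  exact: lt_le_trans epsx.
by rewrite /c min_l// le_eqVlt; apply/orP; left; apply/eqP; ring.
Qed.

(** Both formulas for [u] take the value [m * (e - 2)] at [m], so this term cancels against the left
    piece. The boundary term at [1 - eps] is nonnegative and dropped. *)
Let integral_ge_right eps : 0 < eps < 1 - m ->
  - (beta_kernel a (b + 1) m * (m * (e - 2)))
  <= \int[mu]_(x in `[m, 1 - eps]) f x.
Proof.
move=> /andP[eps0 epsm].
have meps : m < 1 - eps by lra.
have eps1 : 1 - eps < 1 by lra.
pose u x := (e - 1) * x - m.
have du x : is_derive x 1 u (e - 1).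
  by apply: is_derive_eq; rewrite /GRing.scale/=; ring.
have cu : continuous (fun x : R => e - 1) by move=> x; exact: cvg_cst.
apply: le_trans (beta_kernel_increment_le a1 b1 m0 meps eps1 du cu cont_c _).
  have -> : m * (e - 2) = u m by rewrite /u; ring.
  rewrite -[leLHS]add0r lerD2r mulr_ge0 ?beta_kernel_ge0// /u subr_ge0.
  have : 0 <= (e - 2) * (1 - eps).
    by rewrite mulr_ge0 ?subr_ge0 ?e2//; move: m0 meps; lra.
  move: meps; lra.
move=> x /andP[mx xeps]; apply: le_trans (beta_primitive_le_right _) _.
  by move: m0 => m0'; apply/andP; split; lra.
by rewrite /c min_r.
Qed.

Let f_ge_left x : 0 <= x <= m -> 0 <= f x.
Proof.
move=> /andP[x0 xm]; rewrite mulr_ge0 ?beta_kernel_ge0// /c min_l//.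
rewrite mulr_ge0 ?(ltW s0)//; lra.
Qed.

(** A crude bound suffices on the last strip, whose length is [eps]. *)
Let f_ge x : 0 <= x <= 1 -> - ((a + b) * e) <= f x.
Proof.
move=> x01; have k0 := beta_kernel_ge0 a b x.
have k1 := beta_kernel_le1 a1 b1 x01.
have ce : - ((a + b) * e) <= c x.
  rewrite -mulrN ler_wpM2l ?(ltW s0)//.
  have : 0 <= Num.min x m by rewrite le_min (ltW m0) andbT; case/andP: x01.
  move: x01 e2 => /andP[x0 x1]; nra.
have se0 : 0 <= (a + b) * e by rewrite mulr_ge0 ?expR_ge0 ?ltW.
rewrite /f; nra.
Qed.

(** Cuts at [eps], [m] and [1 - eps] give four pieces: the first is nonnegative, the cut at [eps]
    costs [e * eps], and the last strip costs [(a + b) * e * eps]. *)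
Let integral_ge_eps eps : 0 < eps < m -> eps < 1 - m ->
  - (e + (a + b) * e) * eps <= \int[mu]_(x in `[0, 1]) f x.
Proof.
move=> /andP[eps0 epsm] eps1m; have m0' := m0; have m1' := m1.
rewrite (@Rintegral_itv_split _ 0 1 eps); [|by rewrite ltW|by lra|exact: itg].
rewrite (@Rintegral_itv_split _ eps 1 m);
  [|by rewrite ltW|by rewrite ltW|by apply: itg => //; rewrite ltW].
rewrite (@Rintegral_itv_split _ m 1 (1 - eps));
  [|by lra|by lra|by apply: itg => //; rewrite ltW].
have f1 : 0 <= \int[mu]_(x in `[0, eps]) f x.
  apply: Rintegral_ge0 => x /=; rewrite in_itv/= => /andP[x0 xeps].
  by apply: f_ge_left; rewrite x0 (le_trans xeps)// ltW.
have f2 := @integral_ge_left eps; rewrite eps0 epsm in f2.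
have f3 := @integral_ge_right eps; rewrite eps0 eps1m in f3.
have f4 : - ((a + b) * e) * eps <= \int[mu]_(x in `[(1 - eps), 1]) f x.
  pose K := - ((a + b) * e).
  have -> : - ((a + b) * e) * eps = K * 1 - K * (1 - eps) by rewrite /K; ring.
  apply: (@increment_le_Rintegral (fun x => K * x) (fun=> K)).
  - by lra.
  - by move=> x _; apply: is_derive_eq; rewrite /GRing.scale/=; ring.
  - by apply: continuous_subspaceT => x; exact: cvg_cst.
  - by apply: itg; lra.
  - move=> x; rewrite in_itv/= => /andP[x0 x1].
    by apply: f_ge; apply/andP; split; lra.
apply: le_trans (lerD f1 (lerD (f2 isT) (lerD (f3 isT) f4))).
by rewrite le_eqVlt; apply/orP; left; apply/eqP; ring.
Qed.

Lemma beta_kernel_integral_ge0 :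
  0 <= \int[mu]_(x in `[0, 1]) (beta_kernel a b x *
    ((a + b) * (expR 1 * Num.min x (a / (a + b)) - (expR 1 - 1) * x))).
Proof.
rewrite leNgt; apply/negP => J0; set J := Rintegral _ _ _ in J0.
pose C := e + (a + b) * e.
have C0 : 0 < C by rewrite addr_gt0 ?mulr_gt0 ?expR_gt0.
(* The first two bounds keep the cuts in order; the third gives [C * eps <= - J / 2], which
   contradicts [- C * eps <= J < 0]. *)
pose eps := Num.min (m / 2) (Num.min ((1 - m) / 2) (- J / (C * 2))).
have eps0 : 0 < eps.
  rewrite /eps !lt_min; apply/and3P; split; rewrite divr_gt0 ?subr_gt0 ?oppr_gt0//.
  exact: mulr_gt0.
have epsJ : eps * (C * 2) <= - J.
  by rewrite -ler_pdivlMr ?mulr_gt0// /eps !ge_min lexx !orbT.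
have epsm : eps <= m / 2 by rewrite /eps ge_min lexx.
have eps1m : eps <= (1 - m) / 2 by rewrite /eps !ge_min lexx !orbT.
have : - C * eps <= J.
  apply: integral_ge_eps; [apply/andP; split|]; move: m0 m1 eps0 epsm eps1m; lra.
move: J0 epsJ; rewrite mulNr; move: (C) (J) => C' J'; lra.
Qed.

End MinIntegral.

Lemma beta_density_ge0 a b x : 0 <= beta_density a b x.
Proof.
rewrite divr_ge0 ?beta_kernel_ge0// fine_ge0// integral_ge0// => y _.
by rewrite lee_fin beta_kernel_ge0.
Qed.

(** * Normalisation of the Beta law and the expected minimum *)

Section BetaExpectation.
Variables a b : R.
Hypotheses (a1 : 1 <= a) (b1 : 1 <= b).

Lemma beta_norm_gt0 : 0 < beta_norm a b.
Proof.
(* A lower bound of the kernel on [[1/4, 1/2]], where [x >= 1/4] and [1 - x >= 1/2]. *)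
pose K : R := (1/4) `^ (a - 1) * (1/2) `^ (b - 1).
have K0 : 0 < K by rewrite mulr_gt0 ?powR_gt0//; lra.
have int1 : mu.-integrable `[0, 1] (EFin \o beta_kernel a b).
  have -> : beta_kernel a b = fun x => beta_kernel a b x * 1.
    by apply/funext => x; rewrite mulr1.
  apply: integrable_beta_kernelM => //.
  by apply: continuous_subspaceT => x; exact: cvg_cst.
have itg (y z : R) : 0 <= y -> z <= 1 ->
    mu.-integrable `[y, z] (EFin \o beta_kernel a b).
  move=> y0 z1; apply: (integrableS _ _ _ int1) => //=.
  by apply: subset_itvScc; rewrite bnd_simp.
have -> : beta_norm a b = \int[mu]_(x in `[0, 1]) beta_kernel a b x by [].
rewrite (@Rintegral_itv_split _ 0 1 (1/4)); [|by lra|by lra|by apply: itg; lra].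
rewrite (@Rintegral_itv_split _ (1/4) 1 (1/2)); [|by lra|by lra|by apply: itg; lra].
rewrite ltr_wpDl ?Rintegral_ge0//; first by move=> x _; exact: beta_kernel_ge0.
rewrite ltr_wpDr ?Rintegral_ge0//; first by move=> x _; exact: beta_kernel_ge0.
apply: (@lt_le_trans _ _ (K * (1/2) - K * (1/4))); first by lra.
apply: (@increment_le_Rintegral (fun x => K * x) (fun=> K)).
- by lra.
- by move=> x _; apply: is_derive_eq; rewrite /GRing.scale/=; ring.
- by apply: continuous_subspaceT => x; exact: cvg_cst.
- by apply: itg; lra.
- move=> x; rewrite in_itv/= => /andP[x4 x2].
  rewrite /K ler_pM ?powR_ge0//.
    by apply: ge0_ler_powR; rewrite ?nnegrE; move: a1; lra.
  by apply: ge0_ler_powR; rewrite ?nnegrE; move: b1; lra.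
Qed.

Lemma beta_expectE (h : R -> R) : {within `[0, 1], continuous h} ->
  beta_expect a b (fun x => (h x)%:E) =
  ((beta_norm a b)^-1 * \int[mu]_(x in `[0, 1]) (beta_kernel a b x * h x))%:E.
Proof.
move=> ch; have ih := integrable_beta_kernelM a1 b1 ch.
rewrite /beta_expect EFinM /Rintegral fineK; last exact: integrable_fin_num.
rewrite -integralZl//; apply: eq_integral => x _.
by rewrite -!EFinM /beta_density; congr _%:E; ring.
Qed.

(** Removes coordinates on which an integrand does not depend; [c] is extended real because it may
    itself be an expectation. *)
Lemma beta_expect_cst (c : \bar R) : (0 <= c)%E -> beta_expect a b (fun=> c) = c.
Proof.
move=> c0; rewrite /beta_expect ge0_integralZr//.
- suff -> : (\int[mu]_(x in `[0%R, 1%R]) (beta_density a b x)%:E = 1%:E)%E.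
    by rewrite mul1e.
  transitivity (beta_expect a b (fun=> 1%:E)).
    by apply: eq_integral => x _; rewrite mule1.
  rewrite (@beta_expectE (fun=> 1)); last first.
    by apply: continuous_subspaceT => x; exact: cvg_cst.
  have -> : \int[mu]_(x in `[0, 1]) (beta_kernel a b x * 1) = beta_norm a b.
    by apply: eq_Rintegral => x _; rewrite mulr1.
  by rewrite mulVf// gt_eqF// beta_norm_gt0.
- apply/measurable_EFinP; apply: measurable_funTS.
  apply: measurable_funM => //; exact: measurable_beta_kernel.
- by move=> x _; rewrite lee_fin beta_density_ge0.
Qed.

(** The minimum grows with its threshold, so the mean is the worst case. There the comparison
    integral, scaled by [C / ((a + b) * expR 1)], is the required difference up to normalisation. *)
Lemma beta_expect_min (C q : R) : 0 <= C -> a / (a + b) <= q ->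
  ((1 - (expR 1)^-1)%:E * beta_expect a b (fun x => (C * x)%:E) <=
   beta_expect a b (fun x => (C * Num.min x q)%:E))%E.
Proof.
move=> C0 mq.
have s0 : 0 < a + b by move: a1 b1; lra.
have e0 : 0 < expR 1 :> R by exact: expR_gt0.
have c1 : {within `[0, 1], continuous (fun x : R => C * x)}.
  by apply: continuous_subspaceT => x; apply: cvgM; [exact: cvg_cst|exact: cvg_id].
have c2 : {within `[0, 1], continuous (fun x : R => C * Num.min x q)}.
  apply: continuous_subspaceT => x; apply: cvgM; first exact: cvg_cst.
  exact: continuous_min_cst.
have c3 : {within `[0, 1], continuous (fun x : R =>
    (a + b) * (expR 1 * Num.min x (a / (a + b)) - (expR 1 - 1) * x))}.
  apply: continuous_subspaceT => x; apply: cvgM; first exact: cvg_cst.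
  apply: cvgB; apply: cvgM; [exact: cvg_cst| |exact: cvg_cst|exact: cvg_id].
  exact: continuous_min_cst.
pose r : R := 1 - (expR 1)^-1.
have c4 : {within `[0, 1], continuous (fun x : R => r * (C * x))}.
  apply: continuous_subspaceT => x; apply: cvgM; first exact: cvg_cst.
  by apply: cvgM; [exact: cvg_cst|exact: cvg_id].
have c5 : {within `[0, 1], continuous (fun x : R => C * Num.min x q - r * (C * x))}.
  by move=> x; apply: cvgB; [exact: c2|exact: c4].
have c6 : {within `[0, 1], continuous (fun x : R => (C / ((a + b) * expR 1)) *
    ((a + b) * (expR 1 * Num.min x (a / (a + b)) - (expR 1 - 1) * x)))}.
  by move=> x; apply: cvgM; [exact: cvg_cst|exact: c3].
have ik := fun h => @integrable_beta_kernelM a b h a1 b1.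
rewrite !beta_expectE// -EFinM lee_fin mulrCA.
rewrite ler_wpM2l ?invr_ge0 ?(ltW beta_norm_gt0)//.
have -> : (1 - (expR 1)^-1) *
    \int[mu]_(x in `[0, 1]) (beta_kernel a b x * (C * x)) =
    \int[mu]_(x in `[0, 1]) (beta_kernel a b x * (r * (C * x))).
  by rewrite -RintegralZl ?ik//; apply: eq_Rintegral => x _; rewrite mulrCA.
rewrite -subr_ge0 -RintegralB ?ik//.
have := beta_kernel_integral_ge0 a1 b1.
have k0 : 0 <= C / ((a + b) * expR 1).
  by rewrite divr_ge0 ?mulr_ge0 ?(ltW s0) ?(ltW e0).
move=> /(mulr_ge0 k0); rewrite -RintegralZl ?ik// => /le_trans; apply.
under eq_Rintegral do rewrite mulrCA.
under [leRHS]eq_Rintegral do rewrite -mulrBr.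
apply: le_Rintegral => //; [exact: ik|exact: ik|] => x _.
rewrite ler_wpM2l ?beta_kernel_ge0//.
have -> : C / ((a + b) * expR 1) *
    ((a + b) * (expR 1 * Num.min x (a / (a + b)) - (expR 1 - 1) * x)) =
    C * Num.min x (a / (a + b)) - r * (C * x).
  by rewrite /r; field; rewrite !gt_eqF.
by rewrite lerB// ler_wpM2l// le_min !ge_min lexx /= mq orbT.
Qed.

End BetaExpectation.

End BetaInequality.

(** * Pointwise comparison of the two auctions *)

Section Auctions.

Lemma ohead_filter_sub (T : eqType) (P Q : pred T) (s : seq T) x :
  subpred Q P -> Q x -> ohead (seq.filter P s) = Some x ->
  ohead (seq.filter Q s) = Some x.
Proof.
move=> QP Qx; elim: s => //= y s IH.
case: ifPn => [Py /= [yx]|/negP Py /IH]; first by rewrite yx Qx.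
by case: ifPn => // /QP.
Qed.

Variables (R : realType) (n : nat).
Implicit Types r : 'I_n.+1 -> R.

Lemma winnerP r j : r j <= r (winner r).
Proof. by rewrite /winner; case: arg_maxP => //= i _; apply. Qed.

(* [arg max] selects the first maximizer, so shrinking the set of maximizers
   around the selected one keeps the selection. *)
Let argmax_pred r := [pred i | true & [forall (j | true), (r j <= r i)%O]].

(** A maximizer of [r'] reaches the maximum of [r], hence maximizes [r] too; the first-maximizer
    rule then settles ties. *)
Lemma winner_eq r r' : (forall j, r' j <= r j) ->
  r' (winner r) = r (winner r) -> winner r' = winner r.
Proof.
move=> r'r; move eqw : (winner r) => w r'w.
have wmax j : r j <= r w by rewrite -eqw winnerP.
suff : pick (argmax_pred r') = Some w.
  by rewrite /winner /Order.arg_max /extremum => ->.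
apply: (@ohead_filter_sub _ (argmax_pred r)).
- move=> i /= /forallP imax; apply/forallP => j /=.
  by rewrite (le_trans (wmax j))// -r'w (le_trans (imax w)).
- apply/forallP => j /=; rewrite r'w; exact: le_trans (r'r j) _.
- move: eqw; rewrite /winner /Order.arg_max /extremum/= /pick.
  case E : (ohead _) => [i|] /= iw; first by rewrite iw.
  have : winner r \in enum (argmax_pred r).
    rewrite mem_enum; apply/forallP => j /=; exact: winnerP.
  by case: (enum _) E.
Qed.

Lemma max_others_ge0 r j : 0 <= max_others r j.
Proof. exact: bigmax_ge_id. Qed.

(** If the winner changes, the old winner becomes a competitor, and its bid alone already exceeds
    the old second price. *)
Lemma max_others_le r r' : (forall j, r j <= r' j) ->
  max_others r (winner r) <= max_others r' (winner r').
Proof.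
move=> rr'.
have [<-|ww'] := eqVneq (winner r) (winner r').
  by apply: le_bigmax2.
apply: bigmax_le; first exact: max_others_ge0.
move=> i _; apply: le_trans (winnerP r i) _; apply: le_trans (rr' _) _.
exact: le_bigmax_cond.
Qed.

Lemma hybrid_revenue_ge (v q p : 'I_n.+1 -> R) w :
    (forall j, 0 < v j) -> (forall j, 0 < q j) -> (forall j, 0 <= p j) ->
    w = winner (fun j => v j * q j) ->
  max_others (fun j => v j * q j) w / q w * Num.min (p w) (q w) <=
  hybrid_revenue (fun j => v j * p j) v q p.
Proof.
move=> v0 q0 p0 wE; set r := (fun j => _) in wE *; rewrite /hybrid_revenue.
set r' := (fun j => _); set w' := winner r'.
have rr' j : r j <= r' j by rewrite /r' le_max lexx orbT.
have S0 : 0 <= max_others r w by exact: max_others_ge0.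
have Sle : max_others r w <= max_others r' w'.
  by rewrite wE; exact: max_others_le.
case: ifPn => [_|].
  apply: le_trans Sle; rewrite -mulrA -[leRHS]mulr1 ler_wpM2l//.
  by rewrite mulrC ler_pdivrMr// mul1r ge_min lexx orbT.
rewrite -leNgt => le_w'.
(* A per-click winner has effective bid [v w' * q w'], so passing from [r'] to [r] lowers only
   competing bids. *)
have ww' : w = w'.
  by rewrite wE; apply: winner_eq => //; rewrite -/w' /r' max_r.
rewrite -ww' in le_w' Sle *.
rewrite ler_pM// ?divr_ge0// ?(ltW (q0 _))// ?ler_wpM2r ?invr_ge0 ?(ltW (q0 _))//.
  by rewrite le_min p0 ltW.
by rewrite ge_min lexx.
Qed.

End Auctions.

(** * The Gittins index *)

Section Gittins.
Variable R : realType.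
Implicit Types g G a b : R.

(** Every posterior mean is at most [1], so no toss ever pays for its charge. *)
Lemma gitt_V_eq0 g G N a b : 0 < a -> 0 < b -> 1 <= G -> gitt_V g G N a b = 0.
Proof.
move=> a0 b0 G1; elim: N a b a0 b0 => //= N IH a b a0 b0.
rewrite !IH ?addr_gt0// !mulr0 addr0 mulr0 addr0 max_l// subr_le0.
apply: le_trans G1; rewrite ler_pdivrMr ?addr_gt0// mul1r; lra.
Qed.

(** At a charge equal to the mean, one toss followed by retirement breaks even. The bound [1] on
    admissible charges makes the supremum meaningful. *)
Lemma gittins_ge_mean g a b : 0 < a -> 0 < b -> a / (a + b) <=
  gittins g a b.
Proof.
move=> a0 b0; have s0 : 0 < a + b by rewrite addr_gt0.
apply: ub_le_sup.
  exists 1 => G /= G_ge0; rewrite leNgt; apply/negP => G1.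
  have mean1 : a / (a + b) < G.
    by apply: le_lt_trans G1; rewrite ler_pdivrMr// mul1r; lra.
  suff : gitt_value g G a b < 0 by rewrite ltNge G_ge0.
  have -> : gitt_value g G a b = a / (a + b) - G; last by rewrite subr_lt0.
  rewrite -[RHS]sup1; congr sup; apply/seteqP; split=> [_ [N _ <-]|_ ->] /=.
    by rewrite /gitt_W !gitt_V_eq0 ?addr_gt0 ?ltW// !mulr0 addr0 mulr0 addr0.
  by exists 0%N => //; rewrite /gitt_W/= !mulr0 addr0 mulr0 addr0.
(* On a set without a supremum [sup] defaults to [0], which also satisfies the membership
   condition. *)
have [hs|hs] :=
  pselect (has_sup (range (fun N => gitt_W g (a / (a + b)) N a b))).
  apply: (@le_trans _ _ (gitt_W g (a / (a + b)) 0 a b)); last first.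
    by apply: sup_upper_bound => //; exists 0%N.
  by rewrite /gitt_W/= !mulr0 addr0 mulr0 addr0 subrr.
by rewrite /= /gitt_value sup_out.
Qed.

End Gittins.

(** * Iterated Beta expectations *)

(* [integral] of a nonnegative function is a supremum over simple functions
   below it, hence monotone even without measurability; this spares a proof
   that the partially integrated revenues are measurable. *)
Lemma ge0_le_integral_nonmeasurable d (T : measurableType d) (R : realType)
    (nu : {measure set T -> \bar R}) (D : set T) (f g : T -> \bar R) :
    (forall x, D x -> (0 <= f x)%E) -> (forall x, D x -> (f x <= g x)%E) ->
  (\int[nu]_(x in D) f x <= \int[nu]_(x in D) g x)%E.
Proof.
move=> f0 fg.
have g0 x : D x -> (0 <= g x)%E.
  by move=> Dx; exact: le_trans (f0 _ Dx) (fg _ Dx).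
rewrite !ge0_integralE//; apply: ereal.ereal_sup_le => _ [h /= hf <-].
exists h => // x; apply: le_trans (hf x) _.
exact: lee_restrict.
Qed.

Section IteratedExpectation.
Variable R : realType.
Implicit Types a b : R.
Local Open Scope ereal_scope.

Lemma beta_expect_ge0 a b (f : R -> \bar R) :
  (forall x, (0 <= x <= 1)%R -> 0 <= f x) -> 0 <= beta_expect a b f.
Proof.
move=> f0; apply: integral_ge0 => x /= x01; apply: mule_ge0.
  by rewrite lee_fin beta_density_ge0.
by apply: f0; rewrite in_itv/= in x01.
Qed.

Lemma beta_expect_le a b (f h : R -> \bar R) :
  (forall x, (0 <= x <= 1)%R -> 0 <= f x) ->
  (forall x, (0 <= x <= 1)%R -> f x <= h x) ->
  beta_expect a b f <= beta_expect a b h.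
Proof.
move=> f0 fh; apply: ge0_le_integral_nonmeasurable => x /=;
  rewrite in_itv/= => x01.
  by rewrite mule_ge0 ?lee_fin ?beta_density_ge0 ?f0.
by rewrite lee_wpmul2l ?lee_fin ?beta_density_ge0 ?fh.
Qed.

Variables (N : nat) (al be : 'I_N -> R).
Definition unit_cube (p : 'I_N -> R) := forall j, (0 <= p j <= 1)%R.

Let cube_upd (p : 'I_N -> R) i x : unit_cube p -> (0 <= x <= 1)%R ->
  unit_cube (fun j => if j == i then x else p j).
Proof. by move=> cp x01 j; case: ifP. Qed.

Lemma iter_beta_expect_ge0 k (F : ('I_N -> R) -> \bar R) p :
  (forall p, unit_cube p -> 0 <= F p) -> unit_cube p ->
  0 <= iter_beta_expect al be k F p.
Proof.
move=> F0; elim: k p => [|k IH] p cp /=; first exact: F0.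
case: insubP => [i _ _|_]; last exact: IH.
by apply: beta_expect_ge0 => x x01; apply/IH/cube_upd.
Qed.

Lemma iter_beta_expect_le k (F G : ('I_N -> R) -> \bar R) p :
  (forall p, unit_cube p -> 0 <= F p) -> (forall p, unit_cube p -> F p <= G p) ->
  unit_cube p -> iter_beta_expect al be k F p <= iter_beta_expect al be k G p.
Proof.
move=> F0 FG; elim: k p => [|k IH] p cp /=; first exact: FG.
case: insubP => [i _ _|_]; last exact: IH.
apply: beta_expect_le => x x01.
  by apply: iter_beta_expect_ge0 => //; exact: cube_upd.
by apply/IH/cube_upd.
Qed.

Hypotheses (al1 : forall j, (1 <= al j)%R) (be1 : forall j, (1 <= be j)%R).

(** Stage [k] integrates the coordinates below [k]: coordinate [i] yields the expectation of [f],
    every other one integrates a constant. *)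
Lemma iter_beta_expect_coord k (i : 'I_N) (f : R -> \bar R) p :
  (forall x, (0 <= x <= 1)%R -> 0 <= f x) -> unit_cube p ->
  iter_beta_expect al be k (fun p => f (p i)) p =
  if (i < k)%N then beta_expect (al i) (be i) f else f (p i).
Proof.
move=> f0; elim: k p => [//|k IH] p cp /=.
(* If [k] is not a valid index, then [i] is below both [k] and [k.+1]. *)
case: insubP => [j _ jk|]; last first.
  rewrite -leqNgt => Nk; rewrite IH// (leq_trans (ltn_ord i) Nk).
  by rewrite (leq_trans (ltn_ord i))// leqW.
have [ij|ij] := eqVneq i j.
  rewrite -ij in jk *; rewrite jk ltnS leqnn; apply: eq_integral => x.
  rewrite inE/= in_itv/= => x01; rewrite IH; last exact: cube_upd.
  by rewrite jk ltnn eqxx.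
have -> : (i < k.+1)%N = (i < k)%N.
  by rewrite ltnS leq_eqVlt -jk (inj_eq val_inj) (negbTE ij).
rewrite -[RHS](beta_expect_cst (al1 j) (be1 j)); last first.
  by case: ifP => _; [exact: beta_expect_ge0|exact: f0].
apply: eq_integral => x; rewrite inE/= in_itv/= => x01.
rewrite IH; last exact: cube_upd.
by rewrite (negbTE ij).
Qed.

End IteratedExpectation.

(** * Comparison of the expected revenues *)

Unset Implicit Arguments.

Theorem theorem2 (R : realType) (n : nat) (v al be : 'I_n.+1 -> R) (g : R)
  (hv : forall j, 0 < v j)
  (hal : forall j, 1 <= al j) (hbe : forall j, 1 <= be j)
  (hg0 : 0 <= g) (hg1 : g < 1) :
  let q := fun j => gittins g (al j) (be j) in
  ((1 - (expR 1)^-1)%:E *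
     prod_beta_expect al be (fun p => (click_revenue v q p)%:E)
   <= prod_beta_expect al be
        (fun p => (hybrid_revenue (fun j => v j * p j) v q p)%:E))%E.
Proof.
set q := (fun j => _).
have al0 j : 0 < al j by exact: lt_le_trans ltr01 (hal j).
have be0 j : 0 < be j by exact: lt_le_trans ltr01 (hbe j).
have qm j : al j / (al j + be j) <= q j by exact: gittins_ge_mean.
have q0 j : 0 < q j by apply: lt_le_trans (qm j); rewrite divr_gt0 ?addr_gt0.
set w := winner (fun j => v j * q j).
set C := max_others (fun j => v j * q j) w / q w.
have C0 : 0 <= C by rewrite divr_ge0 ?max_others_ge0// ltW.
have cube0 : forall j : 'I_n.+1, 0 <= (0 : R) <= 1.
  by move=> _; rewrite lexx ler01.
have Cmin0 x : 0 <= x <= 1 -> (0 <= (C * Num.min x (q w))%:E)%E.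
  by move=> /andP[x0 _]; rewrite lee_fin mulr_ge0// le_min x0 ltW.
have Cx0 x : 0 <= x <= 1 -> (0 <= (C * x)%:E)%E.
  by move=> /andP[x0 _]; rewrite lee_fin mulr_ge0.
rewrite /prod_beta_expect.
(* By conversion [click_revenue v q p] is [C * p w], with [C] and [w] independent of [p]. *)
rewrite (iter_beta_expect_coord hal hbe n.+1 w Cx0 cube0) ltn_ord.
apply: le_trans (beta_expect_min (hal w) (hbe w) C0 (qm w)) _.
(* The expected minimum is expanded back over all coordinates, so that the pointwise auction bound
   applies under the integrals. *)
have := iter_beta_expect_coord hal hbe n.+1 w Cmin0 cube0; rewrite ltn_ord => <-.
apply: iter_beta_expect_le => // p p01; first exact: Cmin0.
by rewrite lee_fin; apply: hybrid_revenue_ge => // j; case/andP: (p01 j).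
Qed.
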